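(* Let $\{x^r\}_{r=1}^N\subset\mathbb{R}^n$ and $\lambda\ge 0$. For a partition $\{R_i\}_{i=1}^k$ of $\mathbb{R}^n$ and ranks $K_i\in\{0,\dots,n\}$, consider the general piecewise affine autoencoder with piecewise ranks $K_i$, $$G(x):=U_iV_i^Tx+c_i\quad\text{for }x\in R_i,$$ where $U_i,V_i\in\mathbb{R}^{n\times K_i}$, $U_i^TU_i=I$, $c_i\in\mathbb{R}^n$, with loss $$\mathcal{L}=\sum_{i=1}^k\sum_{x^r\in R_i}\|x^r-G(x^r)\|_2^2+\lambda\sum_{i=1}^kN_iK_i .$$ (1) For any fixed partition and ranks, $\mathcal{L}$ is minimised over the parameters $(U_i,V_i,c_i)_{i=1}^k$ by taking, for each $i$ with $N_i\ge1$: $U_i=V_i$ with columns the top $K_i$ normalised (orthonormal) eigenvectors $\{\xi^i_\ell\}_{\ell=1}^{K_i}$ of $X_i$, and $c_i=(I-U_iV_i^T)\bar x_i$. Therefore, at these parameters, $$G(x)=\bar x_i+\sum_{\ell=1}^{K_i}(\xi^i_\ell)^T(x-\bar x_i)\,\xi^i_\ell\quad\text{for }x\in R_i .$$ (2) The resulting minimal value of the loss is $$\mathcal{L}=\sum_{i=1}^k\left[\Big(\sum_{x^r\in R_i}\|x^r-\bar x_i\|_2^2\Big)+N_iK_i\Big(\lambda-\frac1{K_i}\sum_{\ell=1}^{K_i}\lambda_\ell(X_i)\Big)\right],$$ so that the optimal regions $R_i$ are those minimising this expression. (3) For a fixed partition, the expression in (2) is minimised over $K_i\in\{0,\dots,n\}$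 when $\lambda_{K_i}(X_i)>\lambda\ge\lambda_{K_i+1}(X_i)$.
   Context: $N_i:=|\{r:x^r\in R_i\}|$; for $N_i\ge1$, $$\bar x_i:=\frac1{N_i}\sum_{x^r\in R_i}x^r,\qquad X_i:=\frac1{N_i}\sum_{x^r\in R_i}(x^r-\bar x_i)(x^r-\bar x_i)^T,$$ and $\lambda_1(X_i)\ge\dots\ge\lambda_n(X_i)$ are the eigenvalues of $X_i$ in descending order. Conventions: $\lambda_0(X_i):=+\infty$ and $\lambda_{n+1}(X_i):=0$; the term $N_iK_i\big(\lambda-\frac1{K_i}\sum_{\ell=1}^{K_i}\lambda_\ell(X_i)\big)$ is read as $N_i\big(\lambda K_i-\sum_{\ell=1}^{K_i}\lambda_\ell(X_i)\big)$, hence as $0$ when $K_i=0$; regions with $N_i=0$ contribute $0$ to the loss. *)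

(* Defs.v *)
From HB Require Import structures.
From mathcomp Require Import all_boot all_order all_algebra.
From mathcomp Require Import polyrcf.
From mathcomp Require Import boolp classical_sets reals constructive_ereal.

Set Implicit Arguments.
Unset Strict Implicit.
Unset Printing Implicit Defensive.

Import Order.TTheory GRing.Theory Num.Theory.
Local Open Scope classical_set_scope.
Local Open Scope ring_scope.

Section Spectrum.
Context {R : realType} {n : nat}.

(* The real eigenvalues in descending order, each repeated according to its
   algebraic multiplicity.  [rootsR] lists the distinct real roots in
   increasing order.  For a symmetric matrix the list has size n. *)
Definition eigenvalues (X : 'M[R]_n) : seq R :=
  flatten [seq nseq (mup a (char_poly X)) a | a <- rev (rootsR (char_poly X))].

(* Indexed from 1; the value is 0 for l = n + 1. *)
Definition eigval (X : 'M[R]_n) (l : nat) : R := nth 0 (eigenvalues X) l.-1.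

Definition eigval_ext (X : 'M[R]_n) (l : nat) : \bar R :=
  if l == 0%N then +oo%E else (eigval X l)%:E.

(* Column l of U, counted from 0, is an eigenvector for the (l+1)-st largest
   eigenvalue. *)
Definition top_eigenvectors (X : 'M[R]_n) (q : nat) (U : 'M[R]_(n, q)) : Prop :=
  U^T *m U = 1%:M /\
  forall l : 'I_q, X *m col l U = eigval X l.+1 *: col l U.

(* The library's norm on matrices is the sup norm. *)
Definition sqnorm (v : 'cV[R]_n) : R := \sum_(i < n) v i 0 ^+ 2.

End Spectrum.

(* Cells are allowed to be empty, unlike in [classical_sets.partition]. *)
Definition is_partition {T : Type} {k : nat} (P : 'I_k -> set T) : Prop :=
  cover setT P = setT /\ trivIset setT P.

Section Autoencoder.
Context {R : realType} {n k : nat}.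

Record pw_params (K : 'I_k -> 'I_n.+1) := PwParams {
  encU : forall i, 'M[R]_(n, K i);
  encV : forall i, 'M[R]_(n, K i);
  offset : 'I_k -> 'cV[R]_n;
  encU_orthonormal : forall i, (encU i)^T *m encU i = 1%:M }.

Definition autoencoder (P : 'I_k -> set 'cV[R]_n) (K : 'I_k -> 'I_n.+1)
    (theta : pw_params K) (y : 'cV[R]_n) : 'cV[R]_n :=
  if [pick i | y \in P i] is Some i
  then encU theta i *m (encV theta i)^T *m y + offset theta i
  else 0.

Context {N : nat} (x : 'I_N -> 'cV[R]_n).

Definition npts (S : set 'cV[R]_n) : nat := #|[set r | x r \in S]%SET|.

Definition cell_mean (S : set 'cV[R]_n) : 'cV[R]_n :=
  (npts S)%:R^-1 *: \sum_(r < N | x r \in S) x r.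

Definition cell_covariance (S : set 'cV[R]_n) : 'M[R]_n :=
  (npts S)%:R^-1 *:
    \sum_(r < N | x r \in S) (x r - cell_mean S) *m (x r - cell_mean S)^T.

Definition loss (lam : R) (P : 'I_k -> set 'cV[R]_n) (K : 'I_k -> 'I_n.+1)
    (theta : pw_params K) : R :=
  \sum_(i < k) \sum_(r < N | x r \in P i)
      sqnorm (x r - autoencoder P theta (x r))
  + lam * \sum_(i < k) (npts (P i) * K i)%:R.

(* Parameters of cells without data points are left arbitrary. *)
Definition pca_params (P : 'I_k -> set 'cV[R]_n) (K : 'I_k -> 'I_n.+1)
    (theta : pw_params K) : Prop :=
  forall i, (1 <= npts (P i))%N ->
    [/\ top_eigenvectors (cell_covariance (P i)) (encU theta i),
        encV theta i = encU theta i &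
        offset theta i =
          (1%:M - encU theta i *m (encV theta i)^T) *m cell_mean (P i)].

Definition reduced_loss (lam : R) (P : 'I_k -> set 'cV[R]_n)
    (K : 'I_k -> 'I_n.+1) : R :=
  \sum_(i < k)
    (\sum_(r < N | x r \in P i) sqnorm (x r - cell_mean (P i))
     + (npts (P i))%:R *
       (lam * (K i)%:R
        - \sum_(1 <= l < (K i).+1) eigval (cell_covariance (P i)) l)).

End Autoencoder.

(* Main.v *)
(** On a cell, write w for a data point minus the cell mean.  For U with
    orthonormal columns, Pythagoras gives
    |w - U z|^2 = |(I - U U^T) w|^2 + |U^T w - z|^2, so no code z does better
    than projecting, and since the w sum to 0 no offset does better than the
    mean.  What remains is sum |w|^2 - N_i tr(U^T X_i U), and Ky Fan's
    inequality tr(U^T X U) <= lambda_1 + ... + lambda_q bounds the trace, with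
    equality for top eigenvectors.  The optimal rank keeps exactly the positive
    terms of sum (lambda_l - lambda).  The spectral theorem for real symmetric
    matrices comes from a real root of the characteristic polynomial (found
    over R[i]) and deflation by a Householder reflection. *)
Require Import Defs.
From HB Require Import structures.
From mathcomp Require Import all_boot all_order all_algebra all_fingroup.
From mathcomp Require Import polyrcf complex ring lra zify.
From mathcomp Require Import boolp classical_sets reals constructive_ereal.

Set Implicit Arguments.
Unset Strict Implicit.
Unset Printing Implicit Defensive.

Import Order.TTheory GRing.Theory Num.Theory.
Local Open Scope classical_set_scope.
Local Open Scope ring_scope.

(** * Spectral theorem for real symmetric matrices *)

(** Over [R[i]] the characteristic polynomial has a root z, with row eigenvector v. The number v A
    v^* equals z |v|^2 and is its own conjugate because A is real and symmetric, so z is real. *)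
Lemma symmetric_eigenvalue (R : rcfType) n (A : 'M[R]_n.+1) :
  A^T = A -> exists a, eigenvalue A a.
Proof.
move=> symA; pose f := real_complex R; pose Ac := map_mx f A.
have /closed_rootP[z] : size (char_poly Ac) != 1 by rewrite size_char_poly.
rewrite -eigenvalue_root_char => /eigenvalueP[v vA v0].
pose w := map_mx Num.conj v^T.
have AcC : map_mx Num.conj Ac^T = Ac.
  apply/matrixP=> i j; rewrite !mxE -{1}symA mxE.
  by apply/CrealP/complex_realP; exists (A i j).
have s_gt0 : 0 < (v *m w) 0 0.
  rewrite mxE; under eq_bigr do rewrite !mxE -normCK.
  rewrite lt_def sumr_ge0 ?andbT; last by move=> *; rewrite exprn_ge0.
  apply: contraNneq v0 => /eqP; rewrite psumr_eq0; last first.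
    by move=> *; rewrite exprn_ge0.
  move=> /allP /= s0; apply/eqP/rowP => j; rewrite mxE.
  have := s0 j; rewrite mem_index_enum => /(_ isT).
  by rewrite expf_eq0 /= normr_eq0 => /eqP.
have sC : ((v *m w) 0 0)^* = (v *m w) 0 0 by apply/CrealP/gtr0_real.
have : z \is Num.real.
  have e : (v *m Ac *m w) 0 0 = z * (v *m w) 0 0.
    by rewrite vA -scalemxAl mxE.
  have e' : ((v *m Ac *m w) 0 0)^* = (v *m Ac *m w) 0 0.
    transitivity ((map_mx Num.conj (v *m Ac *m w)^T) 0 0); first by rewrite !mxE.
    rewrite !trmx_mul !map_mxM /= AcC mulmxA /w map_trmx trmxK -map_mx_comp.
    by rewrite (map_mx_id (@conjCK _)).
  apply/CrealP; move: e'; rewrite e rmorphM /= sC.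
  by apply: mulIf; rewrite gt_eqF.
move=> /complex_realP[a za]; exists a.
(* Being a root of the characteristic polynomial descends along the embedding of [R] in [R[i]]. *)
rewrite eigenvalue_root_char -(fmorph_root f) map_char_poly -eigenvalue_root_char.
by apply/eigenvalueP; exists v => //; rewrite vA za.
Qed.

Lemma row_dot_gt0 (R : realDomainType) n (v : 'rV[R]_n) :
  v != 0 -> 0 < (v *m v^T) 0 0.
Proof.
move=> v0; rewrite mxE; under eq_bigr do rewrite !mxE -expr2.
rewrite lt_def sumr_ge0 ?andbT; last by move=> *; rewrite sqr_ge0.
apply: contraNneq v0 => /eqP; rewrite psumr_eq0; last first.
  by move=> *; rewrite sqr_ge0.
move=> /allP /= s0; apply/eqP/rowP => j; rewrite mxE.
have := s0 j; rewrite mem_index_enum => /(_ isT).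
by rewrite expf_eq0 => /eqP.
Qed.

(** The reflection in the hyperplane orthogonal to u - e swaps the unit vectors u and e; when they
    coincide, the identity serves. *)
Lemma householder (R : realFieldType) n (u e : 'cV[R]_n) :
  u^T *m u = 1%:M -> e^T *m e = 1%:M ->
  exists H : 'M[R]_n, [/\ H^T = H, H *m H = 1%:M & H *m e = u].
Proof.
move=> uu ee; have [->|ne] := eqVneq u e.
  by exists 1%:M; rewrite trmx1 !mul1mx.
pose w := u - e; pose t := (u^T *m e) 0 0.
have ue : u^T *m e = t%:M by rewrite [LHS]mx11_scalar.
have eu : e^T *m u = t%:M by rewrite -[LHS]trmxK trmx_mul trmxK ue tr_scalar_mx.
have wT : w^T = u^T - e^T by rewrite linearB.
have ww : w^T *m w = (2 - 2 * t)%:M.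
  rewrite wT mulmxBl !mulmxBr uu ee ue eu -!raddfB /=.
  by congr (_%:M); ring.
have s0 : 2 - 2 * t != 0.
  have : w^T != 0 by rewrite -trmx0 (inj_eq trmx_inj) subr_eq0.
  by move=> /row_dot_gt0; rewrite trmxK ww mxE mulr1n => /lt0r_neq0.
(* Since [2 - 2 * t] is |w|^2, this is the coefficient 2 / |w|^2 of the reflection. *)
pose c := 2 / (2 - 2 * t).
have cs : c * (2 - 2 * t) = 2 by rewrite divfK.
exists (1%:M - c *: (w *m w^T)); split.
- by rewrite linearB linearZ /= trmx1 trmx_mul trmxK.
- rewrite mulmxBl mul1mx mulmxBr mulmx1 -scalemxAl -scalemxAr mulmxA.
  rewrite -(mulmxA w) ww mul_mx_scalar -scalemxAl !scalerA.
  rewrite cs -scalerBl -addrA -opprD -scalerDl.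
  by rewrite (_ : c + _ = 0) ?scale0r ?subr0 //; ring.
- rewrite mulmxBl mul1mx -scalemxAl -mulmxA.
  have -> : w^T *m e = (t - 1)%:M.
    by rewrite wT mulmxBl ue ee -raddfB.
  rewrite mul_mx_scalar scalerA (_ : c * _ = -1); last by lra.
  by rewrite scaleN1r opprK addrC subrK.
Qed.

(** Deflation: a reflection H taking the first basis vector to a unit eigenvector makes H A H block
    diagonal with blocks a and Y, and induction diagonalises Y. *)
Theorem symmetric_spectral (R : rcfType) n (A : 'M[R]_n) : A^T = A ->
  exists (Q : 'M_n) (d : 'rV_n), Q^T *m Q = 1%:M /\ A *m Q = Q *m diag_mx d.
Proof.
elim: n A => [|n IHn] A symA.
  by exists 1%:M, 0; split; apply/matrixP => -[].
have [a /eigenvalueP[v vA v0]] := symmetric_eigenvalue symA.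
pose s := (v *m v^T) 0 0.
have s_gt0 : 0 < s := row_dot_gt0 v0.
pose u : 'cV_(1 + n) := (Num.sqrt s)^-1 *: v^T.
have uu : u^T *m u = 1%:M.
  have -> : u^T = (Num.sqrt s)^-1 *: v by rewrite linearZ /= trmxK.
  rewrite -scalemxAl -scalemxAr [v *m _]mx11_scalar -/s.
  rewrite scalerA -invfM -expr2 sqr_sqrtr ?ltW // scale_scalar_mx mulVf //.
  by rewrite gt_eqF.
have Au : A *m u = a *: u.
  rewrite -scalemxAr -{1}symA -trmx_mul vA linearZ /= !scalerA; congr (_ *: _).
  by rewrite mulrC.
pose e : 'cV[R]_(1 + n) := col_mx 1%:M 0.
have ee : e^T *m e = 1%:M.
  by rewrite tr_col_mx mul_row_col trmx1 mul1mx trmx0 mul0mx addr0.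
have [H [Ht HH He]] := householder uu ee.
pose B : 'M_(1 + n) := H *m (A : 'M_(1+n)) *m H.
have Bt : B^T = B by rewrite /B !trmx_mul Ht symA mulmxA.
have Be : B *m e = a *: e.
  rewrite /B -mulmxA He -mulmxA Au -scalemxAr -He mulmxA HH mul1mx //.
(* [Be] describes the first column of [B]; symmetry then clears the rest of the first row. *)
have [Bul Bdl] : ulsubmx B = a%:M /\ dlsubmx B = 0.
  move: Be; rewrite -{1}[B]submxK mul_block_col !mulmx1 !mulmx0 !addr0.
  rewrite scale_col_mx scaler0 => /eq_col_mx[-> ->].
  by rewrite scale_scalar_mx mulr1.
have Bur : ursubmx B = 0.
  by rewrite -[B]Bt -trmx_dlsub Bdl trmx0.
pose Y := drsubmx B.
have Yt : Y^T = Y by rewrite trmx_drsub Bt.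
have [Q [d [QQ YQ]]] := IHn Y Yt.
pose Z : 'M_(1 + n) := block_mx 1%:M 0 0 Q.
have ZZ : Z^T *m Z = 1%:M.
  rewrite /Z tr_block_mx mulmx_block !trmx0 !mulmx0 !mul0mx !addr0 !add0r.
  by rewrite trmx1 mulmx1 QQ -scalar_mx_block.
have BZ : B *m Z = Z *m diag_mx (row_mx a%:M d).
  rewrite -[B]submxK Bul Bdl Bur -/Y mulmx_block diag_mx_row.
  rewrite mulmx_block !mulmx0 !mul0mx !addr0 !add0r !mulmx1 !mul1mx YQ.
  by congr block_mx; apply/matrixP => i j; rewrite !ord1 !mxE.
exists (H *m Z), (row_mx a%:M d); split.
  by rewrite trmx_mul Ht mulmxA -(mulmxA _ H H) HH mulmx1.
by rewrite -[A](mul1mx A) -HH -!mulmxA -BZ /B -!mulmxA.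
Qed.

(** * Ordered eigenvalues and a matching eigenbasis *)

Lemma eigenvalues_sorted (R : realType) n (A : 'M[R]_n) :
  sorted >=%R (eigenvalues A).
Proof.
rewrite /eigenvalues; have : sorted >%R (rev (rootsR (char_poly A))).
  by rewrite rev_sorted /rootsR sorted_roots.
rewrite (sorted_pairwise (@ge_trans _ R)) (sorted_pairwise (rev_trans lt_trans)).
elim: (rev _) => //= a s IHs /andP[/allP gta /IHs {}IHs].
rewrite pairwise_cat IHs andbT; apply/andP; split; last first.
  by elim: (mup _ _) => //= m ->; rewrite andbT all_nseq /= lexx orbT.
apply/allrelP => b c; rewrite mem_nseq => /andP[_ /eqP->].
move=> /flatten_mapP[d ds]; rewrite mem_nseq => /andP[_ /eqP->].
exact/ltW/gta.
Qed.

(** [perm_eq] compares counts, and in both lists the count of b is its multiplicity as a root of the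
    characteristic polynomial. *)
Lemma perm_eigenvalues (R : realType) n (A : 'M[R]_n) (s : seq R) :
  char_poly A = \prod_(a <- s) ('X - a%:P) -> perm_eq (eigenvalues A) s.
Proof.
move=> pA; have p0 : char_poly A != 0 by rewrite monic_neq0 ?char_poly_monic.
apply/allP => b _ /=; apply/eqP; rewrite -[RHS]mu_prod_XsubC -pA.
rewrite /eigenvalues count_flatten.
have ur : uniq (rev (rootsR (char_poly A))).
  by rewrite rev_uniq (sorted_uniq lt_trans ltxx) ?/rootsR ?sorted_roots.
rewrite -map_comp sumnE big_map /=.
under eq_bigr do rewrite count_nseq /=.
have [br|bNr] := boolP (b \in rev (rootsR (char_poly A))).
  rewrite (bigD1_seq b) //= eqxx mul1n big1 ?addn0 // => c.
  by move=> /negPf->.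
rewrite mupNroot; last first.
  apply: contra bNr => rb; rewrite mem_rev.
  by rewrite -(roots_on_rootsR p0) inE rb.
rewrite big_seq big1 // => c cr; case: eqP => [cb|]; rewrite ?mul0n //.
by rewrite -cb cr in bNr.
Qed.

Lemma char_poly_similar_diag (R : realType) n (A Q : 'M[R]_n) d :
  Q^T *m Q = 1%:M -> A *m Q = Q *m diag_mx d ->
  char_poly A = \prod_(i < n) ('X - (d 0 i)%:P).
Proof.
move=> QQ AQ; pose q := map_mx polyC Q; pose q' := map_mx polyC Q^T.
have qq : q' *m q = 1%:M by rewrite -map_mxM QQ map_mx1.
have -> : char_poly A = char_poly (diag_mx d).
  have e : char_poly_mx A = q *m char_poly_mx (diag_mx d) *m q'.
    rewrite /char_poly_mx mulmxBr mulmxBl -map_mxM -AQ map_mxM /= -/q.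
    rewrite -(mulmxA _ q) (mulmx1C qq) mulmx1.
    rewrite mul_mx_scalar -scalemxAl (mulmx1C qq).
    by rewrite scalemx1.
  rewrite /char_poly e !det_mulmx mulrAC -det_mulmx (mulmx1C qq).
  by rewrite det1 mul1r.
rewrite char_poly_trig ?diag_mx_is_trig //.
by apply: eq_bigr => i _; rewrite mxE eqxx.
Qed.

(** The spectral theorem yields the eigenvalues in no particular order. Factoring the characteristic
    polynomial gives a permutation onto the sorted list, and the columns of Q are permuted to
    match. *)
Theorem symmetric_eigenbasis (R : realType) n (A : 'M[R]_n) : A^T = A ->
  size (eigenvalues A) = n /\
  exists Q : 'M_n, Q^T *m Q = 1%:M /\
    A *m Q = Q *m diag_mx (\row_j eigval A j.+1).
Proof.
move=> symA; have [Q [d [QQ AQ]]] := symmetric_spectral symA.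
have pA : char_poly A = \prod_(a <- [tuple d 0 i | i < n]) ('X - a%:P).
  rewrite (char_poly_similar_diag QQ AQ) big_tuple.
  by apply: eq_bigr => i _; rewrite tnth_mktuple.
have := perm_eigenvalues pA => /[dup] /perm_size; rewrite size_tuple => sz.
move=> /tuple_permP[p ep]; split=> //.
have ed i : eigval A (i : 'I_n).+1 = d 0 (p i).
  by rewrite /eigval ep -tnth_nth !tnth_mktuple.
exists (col_perm p Q); split.
  rewrite col_permE trmx_mul -mulmxA (mulmxA _ Q) QQ mul1mx.
  by rewrite tr_perm_mx -perm_mxM mulVg perm_mx1.
apply/matrixP => i j; rewrite mul_mx_diag !mxE ed.
transitivity ((A *m Q) i (p j)); last by rewrite AQ mul_mx_diag !mxE.
by rewrite mxE; apply: eq_bigr => l _; rewrite !mxE.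
Qed.

(* l = 0 is allowed: eigval A 0 is the junk value eigval A 1. *)
Lemma eigval_anti (R : realType) n (A : 'M[R]_n) l m :
  A^T = A -> (l <= m <= n)%N -> eigval A m <= eigval A l.
Proof.
move=> symA /andP[lm mn]; have [sz _] := symmetric_eigenbasis symA.
have [n0|n_gt0] := posnP n.
  by have [-> ->] : l = 0%N /\ m = 0%N by lia.
apply: (sorted_leq_nth (@ge_trans _ R) (@ge_refl _ R) 0 (eigenvalues_sorted A));
  rewrite ?inE ?sz; lia.
Qed.

(** * Ky Fan's inequality and its equality case *)

(* M = W W^T is a symmetric idempotent, so M_ll = sum_j M_lj^2 >= M_ll^2. *)
Lemma orthonormal_row_le1 (R : realType) n q (W : 'M[R]_(n, q)) l :
  W^T *m W = 1%:M -> 0 <= (W *m W^T) l l <= 1.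
Proof.
move=> WW; pose M := W *m W^T.
have MM : M *m M = M by rewrite /M mulmxA -(mulmxA W) WW mulmx1.
have MT : M^T = M by rewrite /M trmx_mul trmxK.
have M_ge0 : 0 <= M l l.
  by rewrite !mxE sumr_ge0 // => j _; rewrite !mxE -expr2 sqr_ge0.
have e : M l l = \sum_j M l j ^+ 2.
  by rewrite -{1}MM mxE; apply: eq_bigr => j _; rewrite -{2}MT [M^T _ _]mxE expr2.
have : M l l ^+ 2 <= M l l.
  by rewrite [leRHS]e (bigD1 l) //= lerDl sumr_ge0 // => j _; rewrite sqr_ge0.
rewrite -/M M_ge0 /=; nra.
Qed.

(** In an eigenbasis Q the trace is a weighted sum of eigenvalues, the weight of [eigval A l.+1]
    being the squared length of row l of W = Q^T U. *)
Lemma ky_fan (R : realType) n q (A : 'M[R]_n) (U : 'M[R]_(n, q)) :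
  A^T = A -> (q <= n)%N -> U^T *m U = 1%:M ->
  \tr (U^T *m A *m U) <= \sum_(l < q) eigval A l.+1.
Proof.
move=> symA qn UU; have [_ [Q [QQ AQ]]] := symmetric_eigenbasis symA.
pose W := Q^T *m U; have UW : U = Q *m W by rewrite mulmxA (mulmx1C QQ) mul1mx.
have WW : W^T *m W = 1%:M by rewrite trmx_mul trmxK -mulmxA -UW.
pose m l := (W *m W^T) l l.
have -> : \tr (U^T *m A *m U) = \sum_(l < n) eigval A l.+1 * m l.
  rewrite -mulmxA {2}UW (mulmxA A) AQ -(mulmxA Q) mulmxA.
  rewrite (_ : U^T *m Q = W^T); last by rewrite trmx_mul trmxK.
  rewrite mxtrace_mulC -mulmxA /mxtrace; apply: eq_bigr => l _.
  by rewrite mul_diag_mx mxE [X in X * _]mxE.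
have m_tr : \sum_(l < n) m l = q%:R.
  by rewrite -[LHS]/(\tr (W *m W^T)) mxtrace_mulC WW mxtrace1.
rewrite (big_ord_widen n (fun l => eigval A l.+1) qn) [leRHS]big_mkcond /=.
(* For q = 0 this reads off the first eigenvalue, which still bounds all the others from above. *)
pose t := eigval A q.
have q_sum : \sum_(l < n) (l < q)%N%:R = q%:R :> R.
  rewrite -natr_sum -big_mkcond /=.
  by rewrite -(big_ord_widen n (fun=> 1%N) qn) sum1_card card_ord.
rewrite -subr_ge0 -sumrB.
(* The weights m_l lie in [0, 1] and sum to q, so shifting every eigenvalue by
   the pivot t changes nothing and makes each summand nonnegative. *)
have -> : \sum_(l < n) ((if (l < q)%N then eigval A l.+1 else 0)
              - eigval A l.+1 * m l)
   = \sum_(l < n) (eigval A l.+1 - t) * ((l < q)%N%:R - m l).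
  rewrite [RHS](eq_bigr (fun l : 'I_n =>
     ((if (l < q)%N then eigval A l.+1 else 0) - eigval A l.+1 * m l)
       - (t * (l < q)%N%:R - t * m l))); last first.
    by move=> l _; case: (l < q)%N => /=; ring.
  by rewrite [RHS]sumrB [X in _ = _ - X]sumrB -!mulr_sumr m_tr q_sum subrr subr0.
apply: sumr_ge0 => l _.
have /andP[m_ge0 m_le1] : 0 <= m l <= 1 := orthonormal_row_le1 l WW.
have [lq|ql] := ltnP l q.
  by rewrite mulr_ge0 ?subr_ge0 // eigval_anti // lq.
rewrite mulr_le0 ?subr_le0 // /t eigval_anti //; have := ltn_ord l; lia.
Qed.

Lemma trace_top_eigenvectors (R : realType) n q (A : 'M[R]_n) (U : 'M[R]_(n, q)) :
  top_eigenvectors A U -> \tr (U^T *m A *m U) = \sum_(l < q) eigval A l.+1.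
Proof.
move=> [UU AU]; have {}AU : A *m U = U *m diag_mx (\row_(l < q) eigval A l.+1).
  apply/matrixP => i l; transitivity (col l (A *m U) i 0); first by rewrite [RHS]mxE.
  by rewrite colE -mulmxA -colE AU mul_mx_diag !mxE mulrC.
rewrite -mulmxA AU mulmxA UU mul1mx mxtrace_diag.
by apply: eq_bigr => l _; rewrite mxE.
Qed.

Lemma top_eigenvectors_exist (R : realType) n q (A : 'M[R]_n) :
  A^T = A -> (q <= n)%N -> exists U : 'M[R]_(n, q), top_eigenvectors A U.
Proof.
move=> symA qn; have [_ [Q [QQ AQ]]] := symmetric_eigenbasis symA.
have AQl l : A *m col l Q = eigval A l.+1 *: col l Q.
  have := congr1 (col l) AQ; rewrite colE -mulmxA -colE mul_mx_diag => ->.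
  by apply/colP => i; rewrite !mxE mulrC.
exists (colsub (widen_ord qn) Q); split; last first.
  move=> l; rewrite (_ : col l _ = col (widen_ord qn l) Q) ?AQl //.
  by apply/colP => i; rewrite !mxE.
apply/matrixP => i j.
transitivity ((Q^T *m Q) (widen_ord qn i) (widen_ord qn j)).
  by rewrite !mxE; apply: eq_bigr => l _; rewrite !mxE.
by rewrite QQ !mxE.
Qed.

(** * Optimal rank by thresholding the spectrum *)

(** The largest q whose q-th eigenvalue exceeds [lam] works; q = 0 always qualifies thanks to the
    value +oo, so a largest one exists. *)
Lemma optimal_rank_exists (R : realType) n (A : 'M[R]_n) lam : 0 <= lam ->
  A^T = A -> exists q : 'I_n.+1,
    (lam%:E < eigval_ext A q)%E /\ (eigval_ext A q.+1 <= lam%:E)%E.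
Proof.
move=> lam_ge0 symA; have [sz _] := symmetric_eigenbasis symA.
have P0 : (lam%:E < eigval_ext A (@ord0 n))%E by rewrite /eigval_ext ltry.
pose q := [arg max_(q > @ord0 n | (lam%:E < eigval_ext A q)%E) (q : nat)]%N.
exists q; rewrite /q; case: arg_maxnP => // {}q lq qmax; split=> //.
(* At q = n the next index falls past the end of the list, where the default 0 is at most [lam]. *)
have [qn|nq] := ltnP q n; last first.
  by rewrite /eigval_ext /eigval /= nth_default ?sz // lee_fin.
rewrite leNgt; apply/negP => lq1.
by have := qmax (Ordinal (qn : q.+1 < n.+1)%N) lq1; rewrite /= ltnn.
Qed.

(** By monotonicity the terms up to q are nonnegative and all later ones nonpositive, so cutting at
    q collects the largest possible sum. *)
Lemma eigval_excess_le (R : realType) n (A : 'M[R]_n) lam q q' :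
  A^T = A -> (q <= n)%N -> (q' <= n)%N ->
  (lam%:E < eigval_ext A q)%E -> (eigval_ext A q.+1 <= lam%:E)%E ->
  \sum_(l < q') (eigval A l.+1 - lam) <= \sum_(l < q) (eigval A l.+1 - lam).
Proof.
move=> symA qn q'n lamq lamq1.
rewrite (big_ord_widen n (fun l => eigval A l.+1 - lam) qn).
rewrite (big_ord_widen n (fun l => eigval A l.+1 - lam) q'n).
rewrite big_mkcond [leRHS]big_mkcond /=; apply: ler_sum => l _.
have [lq|ql] := ltnP l q.
  have : lam <= eigval A l.+1.
    apply: (@le_trans _ _ (eigval A q)); last by rewrite eigval_anti // lq.
    (* [l < q] forces q > 0, so [eigval_ext] is an actual eigenvalue here and not +oo. *)
    by move: lamq; rewrite /eigval_ext gtn_eqF ?(leq_trans _ lq) // lte_fin => /ltW.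
  by case: ifP; rewrite ?subr_ge0.
case: ifP => // _; rewrite subr_le0; move: lamq1; rewrite /eigval_ext lee_fin.
by apply: le_trans; rewrite eigval_anti // !ltnS ql /=.
Qed.

(** * Squared norms and orthonormal frames *)

Lemma sqnorm_dot (R : realType) n (v : 'cV[R]_n) : sqnorm v = (v^T *m v) 0 0.
Proof. by rewrite mxE; apply: eq_bigr => i _; rewrite mxE expr2. Qed.

Lemma sqnorm_trace (R : realType) n (v : 'cV[R]_n) : sqnorm v = \tr (v *m v^T).
Proof. by rewrite mxtrace_mulC sqnorm_dot /mxtrace big_ord1. Qed.

Lemma sqnorm_ge0 (R : realType) n (v : 'cV[R]_n) : 0 <= sqnorm v.
Proof. by apply: sumr_ge0 => i _; apply: sqr_ge0. Qed.

(** In each coordinate the cross terms add up to a multiple of the sum of the [a i], which is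
    zero. *)
Lemma le_sum_sqnorm_shift (R : realType) n (I : finType) (P : pred I)
    (a : I -> 'cV[R]_n) w : \sum_(i | P i) a i = 0 ->
  \sum_(i | P i) sqnorm (a i) <= \sum_(i | P i) sqnorm (a i + w).
Proof.
move=> a0; rewrite exchange_big [leRHS]exchange_big /=; apply: ler_sum => j _.
under [leRHS]eq_bigr do rewrite mxE sqrrD -addrA.
rewrite big_split /= lerDl big_split /= sumrMnl -mulr_suml -summxE a0 mxE.
by rewrite mul0r mul0rn add0r sumr_ge0 // => *; rewrite sqr_ge0.
Qed.

(** w - U z splits into the residual r, orthogonal to the columns of U, and U t, whose length is
    that of t. *)
Lemma sqnorm_sub_frame (R : realType) n q (U : 'M[R]_(n, q))
    (w : 'cV_n) (z : 'cV_q) :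
  U^T *m U = 1%:M ->
  sqnorm (w - U *m z) = sqnorm ((1%:M - U *m U^T) *m w) + sqnorm (U^T *m w - z).
Proof.
move=> UU; set r := _ *m w; set t := U^T *m w - z.
have -> : w - U *m z = r + U *m t.
  by rewrite /r /t mulmxBl mul1mx mulmxBr mulmxA addrA subrK.
have Ur : U^T *m r = 0.
  by rewrite mulmxA mulmxBr mulmx1 mulmxA UU mul1mx subrr mul0mx.
have rU : r^T *m U = 0 by rewrite -[LHS]trmxK trmx_mul trmxK Ur trmx0.
rewrite !sqnorm_dot; suff -> : (r + U *m t)^T *m (r + U *m t) = r^T *m r + t^T *m t.
  by rewrite mxE.
clearbody r t.
have -> : (r + U *m t)^T = r^T + t^T *m U^T.
  by rewrite -trmx_mul; exact: linearD.
rewrite mulmxDl !mulmxDr (mulmxA _ U) rU mul0mx.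
by rewrite addr0 -(mulmxA t^T) Ur mulmx0 add0r -mulmxA (mulmxA U^T) UU mul1mx.
Qed.

Lemma sqnorm_frame_residual (R : realType) n q (U : 'M[R]_(n, q))
    (w : 'cV_n) :
  U^T *m U = 1%:M ->
  sqnorm ((1%:M - U *m U^T) *m w) = sqnorm w - \tr (U^T *m (w *m w^T) *m U).
Proof.
(* The code z = 0 splits |w|^2 itself. *)
move=> UU; have := sqnorm_sub_frame w 0 UU; rewrite mulmx0 !subr0 => ->.
by rewrite [sqnorm (_^T *m _)]sqnorm_trace trmx_mul trmxK !mulmxA addrK.
Qed.

(** * Approximation error on one cell *)

Section Cell.
Variables (R : realType) (n N : nat) (x : 'I_N -> 'cV[R]_n).
Implicit Type S : set 'cV[R]_n.

Lemma npts_eq0 S r : npts x S = 0%N -> (x r \in S) = false.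
Proof.
move=> S0; apply: contra_eqF S0 => rS.
by rewrite -lt0n; apply/card_gt0P; exists r; rewrite inE.
Qed.

(** An empty cell is covered too, both sides being 0, so the identities built on this need no case
    split. *)
Lemma npts_scale_inv (V : lmodType R) S (f : 'I_N -> V) :
  (npts x S)%:R *: ((npts x S)%:R^-1 *: \sum_(r < N | x r \in S) f r) =
  \sum_(r < N | x r \in S) f r.
Proof.
have [S0|S_gt0] := posnP (npts x S).
  by rewrite S0 scale0r big_pred0 // => r; exact: npts_eq0.
by rewrite scalerA mulfV ?scale1r // pnatr_eq0 -lt0n.
Qed.

Lemma centered_sum S : \sum_(r < N | x r \in S) (x r - cell_mean x S) = 0.
Proof.
rewrite sumrB -[X in X - _]npts_scale_inv -/(cell_mean x S).
by rewrite sumr_const /npts cardsE scaler_nat subrr.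
Qed.

Lemma cell_covariance_sym S : (cell_covariance x S)^T = cell_covariance x S.
Proof.
rewrite linearZ /= linear_sum; congr (_ *: _); apply: eq_bigr => r _.
by rewrite /= trmx_mul trmxK.
Qed.

Lemma sum_residual S q (U : 'M[R]_(n, q)) : U^T *m U = 1%:M ->
  \sum_(r < N | x r \in S)
      sqnorm ((1%:M - U *m U^T) *m (x r - cell_mean x S)) =
  \sum_(r < N | x r \in S) sqnorm (x r - cell_mean x S)
    - (npts x S)%:R * \tr (U^T *m cell_covariance x S *m U).
Proof.
move=> UU; under eq_bigr do rewrite sqnorm_frame_residual //.
rewrite sumrB; congr (_ - _).
rewrite -[RHS]mxtraceZ scalemxAl scalemxAr npts_scale_inv.
by rewrite mulmx_sumr mulmx_suml raddf_sum.
Qed.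

(** Dropping the code error leaves B (x r - c), replacing c by the mean lowers the sum again, and Ky
    Fan bounds what remains. *)
Lemma affine_cell_error_ge S q (U V : 'M[R]_(n, q)) c :
  (q <= n)%N -> U^T *m U = 1%:M ->
  \sum_(r < N | x r \in S) sqnorm (x r - cell_mean x S)
    - (npts x S)%:R * \sum_(1 <= l < q.+1) eigval (cell_covariance x S) l
  <= \sum_(r < N | x r \in S) sqnorm (x r - (U *m V^T *m x r + c)).
Proof.
move=> qn UU; rewrite big_add1 big_mkord /=.
pose B := 1%:M - U *m U^T.
apply: (@le_trans _ _ (\sum_(r < N | x r \in S) sqnorm (B *m (x r - c)))).
  apply: (@le_trans _ _ (\sum_(r < N | x r \in S)
      sqnorm (B *m (x r - cell_mean x S)))).
    rewrite sum_residual // lerD2l lerN2 ler_wpM2l ?ler0n //.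
    exact/ky_fan/UU/qn/cell_covariance_sym.
  have -> : \sum_(r < N | x r \in S) sqnorm (B *m (x r - c)) =
    \sum_(r < N | x r \in S) sqnorm (B *m (x r - cell_mean x S)
                                     + B *m (cell_mean x S - c)).
    by apply: eq_bigr => r _; rewrite -mulmxDr addrA subrK.
  apply: le_sum_sqnorm_shift.
  by rewrite -mulmx_sumr centered_sum mulmx0.
(* The error regroups as (x r - c) - U (V^T x r), with code V^T x r. *)
apply: ler_sum => r _; rewrite opprD addrCA addrC -mulmxA sqnorm_sub_frame //.
by rewrite lerDl sqnorm_ge0.
Qed.

Lemma pca_cell_error S q (U : 'M[R]_(n, q)) :
  top_eigenvectors (cell_covariance x S) U ->
  \sum_(r < N | x r \in S)
     sqnorm (x r - (U *m U^T *m x r + (1%:M - U *m U^T) *m cell_mean x S)) =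
  \sum_(r < N | x r \in S) sqnorm (x r - cell_mean x S)
    - (npts x S)%:R * \sum_(1 <= l < q.+1) eigval (cell_covariance x S) l.
Proof.
move=> topU; rewrite big_add1 big_mkord /= -(trace_top_eigenvectors topU).
rewrite -sum_residual; last by case: topU.
apply: eq_bigr => r _; congr sqnorm.
by rewrite mulmxBr opprD addrA; congr (_ - _); rewrite mulmxBl mul1mx.
Qed.

(** * Summing over the cells of a partition *)

Section Partition.
Variables (k : nat).
Implicit Types (P : 'I_k -> set 'cV[R]_n) (K : 'I_k -> 'I_n.+1).

Lemma autoencoderE P K (theta : pw_params K) i y : is_partition P -> y \in P i ->
  autoencoder P theta y = encU theta i *m (encV theta i)^T *m y + offset theta i.
Proof.
move=> [_ trivP] yi; rewrite /autoencoder; case: pickP => [j yj|/(_ i)]; last first.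
  by rewrite yi.
(* Disjoint cells sharing y coincide, so [pick] returns the given cell. *)
suff -> : j = i by [].
by apply: trivP => //; exists y; split; apply/set_mem.
Qed.

Lemma lossE lam P K (theta : pw_params K) : is_partition P ->
  loss x lam P theta = \sum_(i < k)
    (\sum_(r < N | x r \in P i) sqnorm (x r -
        (encU theta i *m (encV theta i)^T *m x r + offset theta i))
     + (npts x (P i))%:R * (lam * (K i)%:R)).
Proof.
move=> partP; rewrite /loss mulr_sumr -big_split /=.
apply: eq_bigr => i _; congr (_ + _); last by rewrite natrM mulrCA.
by apply: eq_bigr => r rP; rewrite (autoencoderE _ partP rP).
Qed.

Lemma reduced_loss_le lam P K (theta : pw_params K) : is_partition P ->
  reduced_loss x lam P K <= loss x lam P theta.
Proof.
move=> partP; rewrite lossE // ler_sum // => i _.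
(* The rank penalty is common to both sides and cancels. *)
rewrite mulrBr addrCA [leRHS]addrC lerD2l.
by apply: affine_cell_error_ge; rewrite ?encU_orthonormal // -ltnS.
Qed.

Lemma pca_lossE lam P K (theta : pw_params K) : is_partition P ->
  pca_params x P theta -> loss x lam P theta = reduced_loss x lam P K.
Proof.
move=> partP pca; rewrite lossE //; apply: eq_bigr => i _.
rewrite mulrBr addrCA [LHS]addrC; congr (_ + _).
have [S0|/pca[topU -> ->]] := posnP (npts x (P i)); last exact: pca_cell_error.
(* [pca_params] says nothing about an empty cell, where both sides sum over no points. *)
by rewrite S0 mul0r subr0 !big_pred0 // => r; exact: npts_eq0.
Qed.

Lemma pca_params_exist P K : exists theta : pw_params K, pca_params x P theta.
Proof.
have exU i : exists U : 'M[R]_(n, K i),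
    top_eigenvectors (cell_covariance x (P i)) U.
  by apply: top_eigenvectors_exist; [exact: cell_covariance_sym | rewrite -ltnS].
pose U i := sval (cid (exU i)).
have topU i : top_eigenvectors (cell_covariance x (P i)) (U i) := svalP (cid (exU i)).
by exists (PwParams U (fun i => (1%:M - U i *m (U i)^T) *m cell_mean x (P i))
             (fun i => (topU i).1)).
Qed.

Lemma pca_autoencoderE P K (theta : pw_params K) i y : is_partition P ->
  pca_params x P theta -> (1 <= npts x (P i))%N -> y \in P i ->
  autoencoder P theta y = cell_mean x (P i) + \sum_(l < K i)
    (((col l (encU theta i))^T *m (y - cell_mean x (P i))) 0 0
       *: col l (encU theta i)).
Proof.
move=> partP pca Pi yi; rewrite (autoencoderE _ partP yi).
have [_ -> ->] := pca i Pi.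
set U := encU _ _; set m := cell_mean _ _.
transitivity (m + U *m (U^T *m (y - m))).
  rewrite mulmxBl mul1mx addrCA; congr (_ + _).
  by rewrite mulmxA mulmxBr.
congr (_ + _); apply/colP => j; rewrite mxE summxE; apply: eq_bigr => l _.
rewrite [RHS]mxE [RHS]mulrC [col l U j 0]mxE; congr (_ * _).
by rewrite !mxE; apply: eq_bigr => h _; rewrite !mxE.
Qed.

End Partition.
End Cell.

(** * Optimal parameters, regions and ranks *)

Theorem theorem2p6 (R : realType) (n N k : nat) (x : 'I_N -> 'cV[R]_n)
    (lam : R) (lam_ge0 : 0 <= lam) :
  (* (1) and the value in (2), for a fixed partition and fixed ranks *)
  (forall (P : 'I_k -> set 'cV[R]_n) (K : 'I_k -> 'I_n.+1),
     is_partition P ->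
     (exists theta : pw_params K, pca_params x P theta) /\
     (forall theta : pw_params K, pca_params x P theta ->
        [/\ forall theta' : pw_params K,
              loss x lam P theta <= loss x lam P theta',
            forall i, (1 <= npts x (P i))%N -> forall y, y \in P i ->
              autoencoder P theta y =
                cell_mean x (P i)
                + \sum_(l < K i)
                    (((col l (encU theta i))^T *m (y - cell_mean x (P i))) 0 0
                     *: col l (encU theta i)) &
            loss x lam P theta = reduced_loss x lam P K])) /\
  (* (2) optimal regions, for fixed ranks *)
  (forall (K : 'I_k -> 'I_n.+1) (P : 'I_k -> set 'cV[R]_n),
     is_partition P ->
     ((exists theta : pw_params K,
         forall (P' : 'I_k -> set 'cV[R]_n) (theta' : pw_params K),
           is_partition P' -> loss x lam P theta <= loss x lam P' theta') <->
      (forall P' : 'I_k -> set 'cV[R]_n, is_partition P' ->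
         reduced_loss x lam P K <= reduced_loss x lam P' K))) /\
  (* (3) optimal ranks, for a fixed partition *)
  (forall (P : 'I_k -> set 'cV[R]_n), is_partition P ->
     let rank_cond (K : 'I_k -> 'I_n.+1) :=
       forall i, (1 <= npts x (P i))%N ->
         (lam%:E < eigval_ext (cell_covariance x (P i)) (K i))%E /\
         (eigval_ext (cell_covariance x (P i)) (K i).+1 <= lam%:E)%E in
     (exists K, rank_cond K) /\
     (forall K, rank_cond K ->
        forall K', reduced_loss x lam P K <= reduced_loss x lam P K')).
Proof.
split; [|split].
- move=> P K partP; split; first exact: pca_params_exist.
  move=> theta pca; split.
  + by move=> theta'; rewrite (pca_lossE _ partP pca) reduced_loss_le.
  + by move=> i Pi y yi; exact: pca_autoencoderE.
  + exact: pca_lossE.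
(* On every partition the reduced loss bounds all losses from below and is attained at PCA
   parameters, so minimising jointly over regions and parameters amounts to minimising the reduced
   loss. *)
- move=> K P partP; split=> [[theta min_theta] P' partP'|min_P].
    have [theta' pca'] := pca_params_exist x P' K.
    rewrite -(pca_lossE _ partP' pca').
    exact: le_trans (reduced_loss_le _ _ _ partP) (min_theta _ _ partP').
  have [theta pca] := pca_params_exist x P K.
  exists theta => P' theta' partP'; rewrite (pca_lossE _ partP pca).
  exact: le_trans (min_P _ partP') (reduced_loss_le _ _ _ partP').
- move=> P partP rank_cond; split.
    have ex_rank i :=
      optimal_rank_exists lam_ge0 (cell_covariance_sym x (P i)).
    by exists (fun i => sval (cid (ex_rank i))) => i _; exact: svalP (cid (ex_rank i)).
  move=> K optK K'; apply: ler_sum => i _; rewrite lerD2l.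
  (* A cell without points costs 0 whatever its rank. *)
  have [->|Pi] := posnP (npts x (P i)); first by rewrite !mul0r.
  have [lamK lamK1] := optK i Pi.
  (* The bracket in [reduced_loss] is minus the total excess of the kept eigenvalues over [lam], so
     lowering it means raising that excess. *)
  have excess q : \sum_(l < q) (eigval (cell_covariance x (P i)) l.+1 - lam) =
      - (lam * q%:R - \sum_(1 <= l < q.+1) eigval (cell_covariance x (P i)) l).
    rewrite sumrB sumr_const card_ord big_add1 big_mkord opprB.
    by rewrite mulr_natr.
  rewrite ler_wpM2l ?ler0n // -lerN2 -!excess.
  by apply: eigval_excess_le; rewrite ?cell_covariance_sym // -ltnS.
Qed.
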